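(* Let $L$ and $L'$ be languages with disjoint value sets $\mathbf V$ and $\mathbf V'$, and let $T:\mathbb T_L\to\mathbb T_{L'}$ be a translation that is correct w.r.t. a semantic translation $R\subseteq\mathbf V'\times\mathbf V$. Let $\equiv_R$ be the smallest equivalence relation on $\mathbf V\cup\mathbf V'$ containing $R$. Then $\equiv_R$ is a 1-hole congruence for $L$.
   Context: Fix a set $\mathcal V$ of variables. A language $L$ consists of a set $\mathbb T_L$ of expressions and a semantic map $[\![\cdot]\!]_L:\mathbb T_L\to((\mathcal V\to\mathbf V)\to\mathbf V)$ for a set of values $\mathbf V$; maps $\rho:\mathcal V\to\mathbf V$ are valuations. A translation from $L$ into $L'$ is any map $T:\mathbb T_L\to\mathbb T_{L'}$. A semantic translation is a relation $R\subseteq\mathbf V'\times\mathbf V$ such that every $v\in\mathbf V$ has some $v'\in\mathbf V'$ with $v'Rv$; for valuations $\eta R\rho$ means $\eta(X)R\rho(X)$ for all $X\in\mathcal V$. $T$ is correct w.r.t. $R$ if $[\![T(E)]\!]_{L'}(\eta)\,R\,[\![E]\!]_L(\rho)$ for all $E\in\mathbb T_L$ and all $\eta:\mathcal V\to\mathbf V'$, $\rho:\mathcal V\to\mathbf V$ with $\eta R\rho$. An equivalence $\approx$ (on a set containing $\mathbf V$) is a 1-hole congruence for $L$ if $[\![E]\!]_L(\nu)\approx[\![E]\!]_L(\rho)$ for every $E\in\mathbb T_L$ and all valuations $\nu,\rho:\mathcal V\to\mathbf V$ for which there is $X\in\mathcal V$ with $\nu(X)\approx\rho(X)$ and $\nu(Y)=\rho(Y)$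 for all $Y\neq X$. *)

(* Defs.v *)
From Stdlib Require Import Relations.

Set Implicit Arguments.

(** [Var] is the set of variables and [V] the set of values. *)
Record language (Var V : Type) := Language {
  expr : Type;
  sem : expr -> (Var -> V) -> V
}.

(** A relation [R] from [V'] to [V] stands for a subset of [V' * V]. *)
Definition semantic_translation (V' V : Type) (R : V' -> V -> Prop) : Prop :=
  forall v : V, exists v' : V', R v' v.

Definition valuation_rel (Var V' V : Type) (R : V' -> V -> Prop)
    (eta : Var -> V') (rho : Var -> V) : Prop :=
  forall X : Var, R (eta X) (rho X).

Definition correct (Var V V' : Type) (L : language Var V) (L' : language Var V')
    (T : expr L -> expr L') (R : V' -> V -> Prop) : Prop :=
  forall (E : expr L) (eta : Var -> V') (rho : Var -> V),
    valuation_rel R eta rho -> R (sem L' (T E) eta) (sem L E rho).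

(** The union of the disjoint sets [V] and [V'] is the sum type [V + V'];
    [union_rel R] is [R] seen as a binary relation on that union. *)
Inductive union_rel (V V' : Type) (R : V' -> V -> Prop) : relation (V + V') :=
  union_rel_intro : forall (v' : V') (v : V),
    R v' v -> union_rel R (inr v') (inl v).

(** [clos_refl_sym_trans] is the smallest equivalence relation containing its
    argument; reflexivity holds on the whole of [V + V']. *)
Definition equiv_of (V V' : Type) (R : V' -> V -> Prop) : relation (V + V') :=
  clos_refl_sym_trans (V + V') (union_rel R).

(** [approx] lives on a set [U] containing [V], the inclusion being given by the
    embedding [i]. *)
Definition one_hole_congruence (Var V U : Type) (L : language Var V)
    (i : V -> U) (approx : relation U) : Prop :=
  equivalence U approx /\
  forall (E : expr L) (nu rho : Var -> V),
    (exists X : Var, approx (i (nu X)) (i (rho X)) /\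
       forall Y : Var, Y <> X -> nu Y = rho Y) ->
    approx (i (sem L E nu)) (i (sem L E rho)).

(* Main.v *)
(** A chain of [R]-steps between two elements of [V] alternates between [V] and
    [V'], so on [V] the relation [equiv_of R] is generated by having a common
    [R]-source in [V'].  If two valuations into [V] differ only at [X], where
    their values have a common source, then some single valuation into [V'] is
    [R]-related to both; correctness of the translation then provides a common
    source of the two meanings. *)

Require Import Defs.
From Stdlib Require Import Relations Classical IndefiniteDescription.

Lemma equiv_of_inl_ind (V V' : Type) (R : V' -> V -> Prop) (S : relation V) :
  reflexive V S -> transitive V S ->
  (forall v' a b, R v' a -> R v' b -> S a b) ->
  forall a b, equiv_of R (inl a) (inl b) -> S a b.
Proof.
  intros Srefl Strans Ssource a b H.
  apply clos_rst_rst1n in H.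
  (* At an intermediate [v' : V'] all the [R]-targets of [v'] are considered;
     there is at least one, namely the preceding element of the chain. *)
  change ((fun u => match u with
    | inl c => S c b
    | inr v' => forall c, R v' c -> S c b
    end) (inl a)).
  remember (inl b) as w eqn:Ew.
  induction H as [u | u y w Huy _ IH]; subst.
  - apply Srefl.
  - specialize (IH eq_refl).
    destruct Huy as [Huy | Huy].
    + destruct Huy as [v' v Hv]. intros c Hc.
      apply Strans with v; [now apply Ssource with v' | exact IH].
    + destruct Huy as [v' v Hv]. now apply IH.
Qed.

Definition agree_off (Var V : Type) (X : Var) (nu rho : Var -> V) : Prop :=
  forall Y, Y <> X -> nu Y = rho Y.

(** Equality on [Var] need not be decidable, so the update comes from classical choice. *)
Lemma update_exists (Var V : Type) (X : Var) (rho : Var -> V) (c : V) :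
  exists mu, mu X = c /\ agree_off Var V X mu rho.
Proof.
  destruct (functional_choice
    (fun Y v => (Y = X -> v = c) /\ (Y <> X -> v = rho Y))) as [mu Hmu].
  - intros Y. destruct (classic (Y = X)); [exists c | exists (rho Y)]; tauto.
  - exists mu. split; [now apply Hmu | intros Y; apply Hmu].
Qed.

Lemma equiv_of_common_source (V V' : Type) (R : V' -> V -> Prop) v' a b :
  R v' a -> R v' b -> equiv_of R (inl a) (inl b).
Proof.
  intros Ha Hb. apply rst_trans with (inr v').
  - apply rst_sym, rst_step. now constructor.
  - apply rst_step. now constructor.
Qed.

Lemma sem_equiv_of_common_source (Var V V' : Type) (L : language Var V)
    (L' : language Var V') (T : expr L -> expr L') (R : V' -> V -> Prop)
    (hT : correct L L' T R) (E : expr L) (nu rho : Var -> V) :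
  (forall Y, exists v', R v' (nu Y) /\ R v' (rho Y)) ->
  equiv_of R (inl (sem L E nu)) (inl (sem L E rho)).
Proof.
  intros H. destruct (functional_choice _ H) as [eta Heta].
  apply equiv_of_common_source with (sem L' (T E) eta);
    apply hT; intros Y; apply Heta.
Qed.

Theorem theorem3 (Var V V' : Type) (L : language Var V) (L' : language Var V')
    (T : expr L -> expr L') (R : V' -> V -> Prop)
    (hR : semantic_translation R) (hT : correct L L' T R) :
  one_hole_congruence L (@inl V V') (equiv_of R).
Proof.
  split; [apply clos_rst_is_equiv |].
  intros E nu rho [X [HX Hoff]].
  assert (Hsource : forall v' a b, R v' a -> R v' b ->
    forall mu1 mu2, mu1 X = a -> mu2 X = b -> agree_off Var V X mu1 mu2 ->
    equiv_of R (inl (sem L E mu1)) (inl (sem L E mu2))).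
  { intros v' a b Ha Hb mu1 mu2 <- <- Hmu.
    apply (sem_equiv_of_common_source _ _ _ _ _ _ _ hT). intros Y.
    destruct (classic (Y = X)) as [-> | HY]; [now exists v' |].
    (* Off [X] the values coincide, and totality of [R] gives them a source. *)
    rewrite (Hmu Y HY). destruct (hR (mu2 Y)) as [w Hw]. now exists w. }
  (* Quantifying over [mu1] and [mu2] lets transitivity pass through a third valuation taking the
     middle value at [X]. *)
  refine (equiv_of_inl_ind V V' R (fun a b => forall mu1 mu2,
    mu1 X = a -> mu2 X = b -> agree_off Var V X mu1 mu2 ->
    equiv_of R (inl (sem L E mu1)) (inl (sem L E mu2)))
    _ _ Hsource _ _ HX nu rho eq_refl eq_refl Hoff).
  (* Here [mu1] and [mu2] agree only pointwise; a source of [a] replaces extensionality. *)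
  - intros a. destruct (hR a) as [v' Hv']. now apply Hsource with v'.
  - intros a b c Hab Hbc mu1 mu2 H1 H2 H12.
    destruct (update_exists Var V X mu2 b) as [mu [Hmu Hmu2]].
    apply rst_trans with (inl (sem L E mu)).
    + apply Hab; trivial. intros Y HY.
      now rewrite (H12 Y HY), (Hmu2 Y HY).
    + now apply Hbc.
Qed.
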